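(* Let $K$ be a field with $\mathrm{char}(K)\neq 2$. Let $a_1,a_2,a_3\in K$ be such that $\pm a_1,\pm a_2,\pm a_3$ are six distinct elements of $K$ and none of $$\beta_1=-a_1^2+a_2^2+a_3^2,\quad \beta_2=a_1^2-a_2^2+a_3^2,\quad \beta_3=a_1^2+a_2^2-a_3^2$$ vanishes. Then: (i) none of the $a_i$ vanishes, and $\beta_1^2,\beta_2^2,\beta_3^2$ are three distinct elements of $K$. (ii) Consider the elliptic curve $E_{5;a_1,a_2,a_3}: y^2=\left(x+\frac{\beta_1^2}{4}\right)\left(x+\frac{\beta_2^2}{4}\right)\left(x+\frac{\beta_3^2}{4}\right)$ and the point $P=(0,-\beta_1\beta_2\beta_3/8)\in E_{5;a_1,a_2,a_3}(K)$. Then (1) $P\in 2E_{5;a_1,a_2,a_3}(K)$; and (2) if $$a_1^3+a_2^3+a_3^3-a_1^2a_2-a_1a_2^2-a_2^2a_3-a_2a_3^2-a_1^2a_3-a_1a_3^2-2a_1a_2a_3=0$$ and $$(a_1+a_2+a_3)(a_1-a_2-a_3)(a_1+a_2-a_3)(a_1-a_2+a_3)\neq0,$$ then $P$ has order $5$, and $E_{5;a_1,a_2,a_3}(K)$ contains a subgroup isomorphic to $\mathbb{Z}/10\mathbb{Z}\oplus\mathbb{Z}/2\mathbb{Z}$. *)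

(* Defs.v *)
From HB Require Import structures.
From mathcomp Require Import all_boot all_order all_algebra.
From mathcomp Require Import separable.
From mathcomp Require Import ring zify.

Set Implicit Arguments.
Unset Strict Implicit.
Unset Printing Implicit Defensive.

Import GRing.Theory.
Local Open Scope ring_scope.

Section CoordRing.
Variable K : fieldType.

(* K[x, y] / (y^2 - f(x)); the pair (u, v) stands for u(x) + v(x) y. *)
Definition coordring (f : {poly K}) : Type := ({poly K} * {poly K})%type.

Variable f : {poly K}.
HB.instance Definition _ := GRing.Zmodule.on (coordring f).

Definition crmul (g h : coordring f) : coordring f :=
  (g.1 * h.1 + g.2 * h.2 * f, g.1 * h.2 + g.2 * h.1).

Lemma crmulA : associative crmul.
Proof. by move=> [a b] [c d] [u v]; congr (_, _) => /=; ring. Qed.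
Lemma crmulC : commutative crmul.
Proof. by move=> [a b] [c d]; congr (_, _) => /=; ring. Qed.
Lemma crmul1 : left_id ((1, 0) : coordring f) crmul.
Proof. by move=> [a b]; congr (_, _) => /=; ring. Qed.
Lemma crmulD : left_distributive crmul +%R.
Proof. by move=> [a b] [c d] [u v]; congr (_, _) => /=; ring. Qed.
Lemma cr1_neq0 : ((1, 0) : coordring f) != 0.
Proof. by apply/eqP => -[/eqP]; rewrite oner_eq0. Qed.

HB.instance Definition _ := GRing.Zmodule_isComNzRing.Build (coordring f)
  crmulA crmulC crmul1 crmulD cr1_neq0.

Definition crX (u : {poly K}) : coordring f := (u, 0).
Definition crY : coordring f := (0, 1).
Definition crnorm (g : coordring f) : {poly K} := g.1 ^+ 2 - g.2 ^+ 2 * f.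
Definition crconj (g : coordring f) : coordring f := (g.1, - g.2).
Definition creval (a b : K) (g : coordring f) : K := g.1.[a] + g.2.[a] * b.

Lemma cr_mulE (g h : coordring f) :
  g * h = (g.1 * h.1 + g.2 * h.2 * f, g.1 * h.2 + g.2 * h.1).
Proof. by []. Qed.
Lemma cr_eqP (g h : coordring f) : g.1 = h.1 -> g.2 = h.2 -> g = h.
Proof. by case: g h => [a b] [c d] /= -> ->. Qed.
Lemma cr_decomp (g : coordring f) : g = crX g.1 + crX g.2 * crY.
Proof. by apply: cr_eqP => /=; ring. Qed.
Lemma crXD u v : crX (u + v) = crX u + crX v.
Proof. by apply: cr_eqP => /=; ring. Qed.
Lemma crXM u v : crX (u * v) = crX u * crX v.
Proof. by apply: cr_eqP => /=; ring. Qed.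
Lemma crXN u : crX (- u) = - crX u.
Proof. by apply: cr_eqP => /=; ring. Qed.
Lemma crYY : crY * crY = crX f.
Proof. by apply: cr_eqP => /=; ring. Qed.
Lemma crnormM g h : crnorm (g * h) = crnorm g * crnorm h.
Proof. by rewrite /crnorm cr_mulE /=; ring. Qed.
Lemma crmul_conj g : g * crconj g = crX (crnorm g).
Proof. by apply: cr_eqP; rewrite /crnorm /=; ring. Qed.
Lemma crevalD a b g h : creval a b (g + h) = creval a b g + creval a b h.
Proof. by rewrite /creval /= !hornerD; ring. Qed.
Lemma crevalM a b g h : b ^+ 2 = f.[a] ->
  creval a b (g * h) = creval a b g * creval a b h.
Proof.
move=> hb; rewrite /creval cr_mulE /= !(hornerD, hornerM) -hb; ring.
Qed.

Lemma crX_inj (c : {poly K}) (g h : coordring f) :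
  c != 0 -> crX c * g = crX c * h -> g = h.
Proof.
move=> c0; rewrite !cr_mulE /= !mul0r !addr0 => -[/(mulfI c0) e1 /(mulfI c0) e2].
exact: cr_eqP.
Qed.

Lemma cr_cancel (c g h : coordring f) : crnorm c != 0 -> c * g = c * h -> g = h.
Proof.
move=> c0 e; apply: (crX_inj c0).
by rewrite -crmul_conj !(mulrC c) -!mulrA e.
Qed.

Definition cideal (S : coordring f -> Prop) :=
  [/\ S 0, forall a b, S a -> S b -> S (a + b) & forall r a, S a -> S (r * a)].

Definition iprod (I J : coordring f -> Prop) (x : coordring f) : Prop :=
  forall N, cideal N -> (forall i j, I i -> J j -> N (i * j)) -> N x.

Lemma iprod_ideal I J : cideal (iprod I J).
Proof.
split=> [N [] //|a b Ha Hb N HN HIJ|r a Ha N HN HIJ]; have [_ hD hM] := HN.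
- by apply: (hD); [apply: Ha | apply: Hb].
- by apply: (hM); apply: Ha.
Qed.

Lemma iprod_mem (I J : coordring f -> Prop) i j :
  I i -> J j -> iprod I J (i * j).
Proof. by move=> Ii Jj N _; apply. Qed.

Lemma iprodC I J x : iprod I J x -> iprod J I x.
Proof. by apply=> [|i j Ii Jj]; [exact: iprod_ideal | rewrite mulrC; apply: iprod_mem]. Qed.

Lemma iprodA I J L x : iprod (iprod I J) L x -> iprod I (iprod J L) x.
Proof.
apply=> [|ij l Hij Ll]; first exact: iprod_ideal.
apply: (Hij (fun z => iprod I (iprod J L) (z * l))) => [|i j Ii Jj]; last first.
  by rewrite -mulrA; do 2?[apply: iprod_mem => //].
have [h0 hD hM] := iprod_ideal I (iprod J L).
split; first by rewrite mul0r.
- by move=> a b Ha Hb; rewrite mulrDl; apply: (hD).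
- by move=> r a Ha; rewrite -mulrA; apply: (hM).
Qed.

Lemma iprodA' I J L x : iprod I (iprod J L) x -> iprod (iprod I J) L x.
Proof.
apply=> [|i jl Ii Hjl]; first exact: iprod_ideal.
apply: (Hjl (fun z => iprod (iprod I J) L (i * z))) => [|j l Jj Ll]; last first.
  by rewrite mulrA; do 2?[apply: iprod_mem => //].
have [h0 hD hM] := iprod_ideal (iprod I J) L.
split; first by rewrite mulr0.
- by move=> a b Ha Hb; rewrite mulrDr; apply: (hD).
- by move=> r a Ha; rewrite mulrCA; apply: (hM).
Qed.

(* I and J lie in the same ideal class: g I = h J with g, h nonzero. *)
Definition ceq (I J : coordring f -> Prop) :=
  exists g h, [/\ crnorm g != 0, crnorm h != 0,
    forall i, I i -> exists2 j, J j & g * i = h * j &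
    forall j, J j -> exists2 i, I i & g * i = h * j].

Lemma crnorm1 : crnorm 1 = 1.
Proof. by rewrite /crnorm /=; ring. Qed.

Lemma ceq_ext I J : (forall x, I x -> J x) -> (forall x, J x -> I x) -> ceq I J.
Proof.
move=> IJ JI; exists 1, 1; rewrite crnorm1 oner_eq0; split=> // x Hx; exists x; auto.
Qed.
Lemma ceq_sym I J : ceq I J -> ceq J I.
Proof.
case=> g [h [g0 h0 H1 H2]]; exists h, g; split=> // x.
  by case/H2 => i Ii e; exists i.
by case/H1 => i Ii e; exists i.
Qed.
Lemma ceq_trans J I L : ceq I J -> ceq J L -> ceq I L.
Proof.
case=> g [h [g0 h0 H1 H2]] [g' [h' [g0' h0' H1' H2']]].
exists (g' * g), (h * h'); rewrite !crnormM !mulf_neq0 //; split=> // x.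
  case/H1 => j /H1' [l Ll e'] e; exists l => //.
  by rewrite -!mulrA e -e' mulrCA.
case/H2' => j /H2 [i Ii e] e'; exists i => //.
by rewrite -!mulrA e -e' mulrCA.
Qed.
Lemma ceq_iprodl S I J : ceq I J -> ceq (iprod I S) (iprod J S).
Proof.
have key I' J' g h : (forall i, I' i -> exists2 j, J' j & g * i = h * j) ->
    forall i, iprod I' S i -> exists2 j, iprod J' S j & g * i = h * j.
  move=> H i Hi; apply: (Hi (fun i => exists2 j, iprod J' S j & g * i = h * j)) => [|i' s /H[j Jj e] Ss]; last first.
    by exists (j * s); [apply: iprod_mem | rewrite !mulrA e].
  have [k0 kD kM] := iprod_ideal J' S.
  split; first by exists 0; rewrite ?mulr0.
  - by move=> a b [c Jc ec] [d Jd ed]; exists (c + d); rewrite ?mulrDr ?ec ?ed; auto.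
  - by move=> r a [c Jc ec]; exists (r * c); [auto | rewrite !(mulrCA _ r) ec].
case=> g [h [g0 h0 H1 H2]]; exists g, h; split=> //; first exact: key.
move=> j Jj; have H2' k : J k -> exists2 i, I i & h * k = g * i.
  by case/H2 => i Ii e; exists i.
by have [i Ii e] := key _ _ _ _ H2' _ Jj; exists i.
Qed.
Lemma ceq_iprodr S I J : ceq I J -> ceq (iprod S I) (iprod S J).
Proof.
move=> /(ceq_iprodl S) H.
apply: (@ceq_trans (iprod I S)); first by apply: ceq_ext => x; apply: iprodC.
by apply: (ceq_trans H); apply: ceq_ext => x; apply: iprodC.
Qed.

(* Associativity of the group law is read off the ideal classes of the maximal
   ideals of points; the point at infinity gives the unit ideal. *)
Definition ptideal (p : option (K * K)) (g : coordring f) : Prop :=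
  if p is Some (a, b) then creval a b g = 0 else True.

Lemma ptidealP a b g : b ^+ 2 = f.[a] -> ptideal (Some (a, b)) g <->
  exists r s, g = r * crX ('X - a%:P) + s * (crY - crX b%:P).
Proof.
move=> hb; split=> [/= H|[r [s ->]]]; last first.
  rewrite /= crevalD !crevalM // /creval /= !hornerE; ring.
have /factor_theorem [q Hq] : root (g.1 + g.2 * b%:P) a.
  by rewrite /root !hornerE; apply/eqP.
exists (crX q), (crX g.2); rewrite -crXM -Hq {1}[g]cr_decomp.
by rewrite crXD crXM; ring.
Qed.

Lemma ptideal_ideal a b : b ^+ 2 = f.[a] -> cideal (ptideal (Some (a, b))).
Proof.
move=> hb; split=> [|g h|r g] /=; first by rewrite /creval /= !hornerE.
  by rewrite crevalD => -> ->; rewrite addr0.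
by rewrite crevalM // => ->; rewrite mulr0.
Qed.

End CoordRing.

(* y^2 = f(x) over K is an elliptic curve with the point at infinity as origin;
   a smooth Weierstrass equation of this shape exists only outside
   characteristic 2. *)
Definition elliptic_cubic (K : fieldType) (f : {poly K}) : bool :=
  [&& 2%N \notin [pchar K], f \is monic, size f == 4%N & separable_poly f].

Record ellcurve (K : fieldType) := EllCurve {
  ecpoly : {poly K};
  ecpolyP : elliptic_cubic ecpoly
}.

(* None is the point at infinity. *)
Definition on_curve (K : fieldType) (f : {poly K}) (p : option (K * K)) : bool :=
  if p is Some (x, y) then y ^+ 2 == f.[x] else true.

Record ecpoint (K : fieldType) (E : ellcurve K) := EcPoint {
  eccoord : option (K * K);
  eccoordP : on_curve (ecpoly E) eccoord
}.

HB.instance Definition _ K (E : ellcurve K) := [isSub for @eccoord K E].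
HB.instance Definition _ K (E : ellcurve K) := [Choice of ecpoint E by <:].

(* Chord-and-tangent law; f`_2 is the coefficient of x^2 in the monic cubic f. *)
Definition ecadd (K : fieldType) (f : {poly K}) (p q : option (K * K)) :
    option (K * K) :=
  match p, q with
  | None, _ => q
  | _, None => p
  | Some (x1, y1), Some (x2, y2) =>
    if (x1 == x2) && (y1 == - y2) then None else
    let l := if x1 == x2 then f^`().[x1] / (2 * y1) else (y2 - y1) / (x2 - x1) in
    let x3 := l ^+ 2 - f`_2 - x1 - x2 in
    Some (x3, l * (x1 - x3) - y1)
  end.

Definition ecopp (K : fieldType) (p : option (K * K)) : option (K * K) :=
  if p is Some (x, y) then Some (x, - y) else None.

Section GroupLaw.
Variables (K : fieldType) (E : ellcurve K).
Local Notation f := (ecpoly E).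
Local Notation pt := (option (K * K)).
Local Notation onc := (on_curve f).
Local Notation cX := (@crX K f).
Local Notation cY := (crY f).
Local Notation Ip := (@ptideal K f).

Let n2 : (2 : K) != 0.
Proof. by have /and4P[] := ecpolyP E; rewrite inE. Qed.
Let fm : f \is monic.
Proof. by have /and4P[] := ecpolyP E. Qed.
Let fs : size f = 4%N.
Proof. by have /and4P[_ _ /eqP] := ecpolyP E. Qed.
Let fsep : separable_poly f.
Proof. by have /and4P[] := ecpolyP E. Qed.

Lemma half2 (y : K) : y != 0 -> (2 * y)^-1 * (y + y) = 1.
Proof. by move=> y0; field; rewrite y0 n2. Qed.

Lemma ec_root_deriv a : f.[a] = 0 -> f^`().[a] != 0.
Proof.
move=> fa; have := fsep; rewrite separable_poly.unlock => /coprimep_root; apply.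
by rewrite /root fa.
Qed.

Lemma cubic_factor (q : {poly K}) x1 x2 : q \is monic -> size q = 4%N ->
  ('X - x1%:P) * ('X - x2%:P) %| q ->
  q = ('X - x1%:P) * ('X - x2%:P) * ('X - (- q`_2 - x1 - x2)%:P).
Proof.
move=> qm qs /dvdpP [r qE].
have sD : size (('X - x1%:P) * ('X - x2%:P)) = 3%N.
  by rewrite size_Mmonic ?monicXsubC ?polyXsubC_eq0 ?size_XsubC // -size_poly_eq0 size_XsubC.
have Dm : ('X - x1%:P) * ('X - x2%:P) \is monic by rewrite monicMl monicXsubC.
have rm : r \is monic by rewrite -(monicMr _ Dm) -qE.
have sr : size r = 2%N.
  move: qs; rewrite qE size_Mmonic ?monic_neq0 // sD addn3 /=.
  by case.
have [c rE] : exists c, r = 'X - c%:P.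
  exists (- r`_0); apply/polyP => i; rewrite coefB coefX coefC.
  case: i => [|[|i]] /=; rewrite ?sub0r ?opprK ?subr0 //.
    by move/monicP: rm; rewrite lead_coefE sr.
  by rewrite oppr0 nth_default ?sr.
rewrite {1}qE rE mulrC; congr (_ * ('X - _%:P)).
have -> : q = 'X^3 + (- (x1 + x2 + c)) *: 'X^2 + (x1 * x2 + x1 * c + x2 * c) *: 'X - (x1 * x2 * c)%:P.
  rewrite qE rE -!mul_polyC !polyCN !polyCD !polyCM; ring.
rewrite !(coefB, coefD, coefZ, coefXn, coefX, coefC) /=; ring.
Qed.

Let lam x1 y1 x2 y2 : K :=
  if x1 == x2 then f^`().[x1] / (2 * y1) else (y2 - y1) / (x2 - x1).

Lemma ec_line x1 y1 x2 y2 (l := lam x1 y1 x2 y2) : onc (Some (x1, y1)) ->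
  onc (Some (x2, y2)) -> ~~ ((x1 == x2) && (y1 == - y2)) ->
  y2 = l * (x2 - x1) + y1 /\
  f - (l *: ('X - x1%:P) + y1%:P) ^+ 2 =
    ('X - x1%:P) * ('X - x2%:P) * ('X - (l ^+ 2 - f`_2 - x1 - x2)%:P).
Proof.
move=> /eqP h1 /eqP h2 hne.
have hl : y2 = l * (x2 - x1) + y1.
  rewrite /l /lam; move: hne; have [e|ne _] := eqVneq x1 x2; last first.
    by rewrite divfK ?subrK // subr_eq0 eq_sym.
  rewrite e /= => ne; rewrite subrr mulr0 add0r.
  have /eqP : y1 ^+ 2 = y2 ^+ 2 by rewrite h1 h2 e.
  by rewrite eqf_sqr (negPf ne) orbF => /eqP.
split=> //.
set L := l *: ('X - x1%:P) + y1%:P; set q := f - L ^+ 2.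
have LE : L = l *: 'X + (y1 - l * x1)%:P.
  by rewrite /L -!mul_polyC polyCB polyCM; ring.
have L2 : L ^+ 2 = (l ^+ 2) *: 'X^2 + (2 * l * (y1 - l * x1)) *: 'X + ((y1 - l * x1) ^+ 2)%:P.
  by rewrite LE -!mul_polyC -/(2%:R) !(polyCB, polyCM, polyC_exp, polyC1) ?polyC_natr; ring.
have sL : (size (L ^+ 2) < size f)%N.
  rewrite fs ltnS L2; apply/leq_sizeP => -[|[|[|j]]] // _.
  by rewrite !(coefD, coefZ, coefXn, coefX, coefC) /= !mulr0 !addr0.
have qs : size q = 4%N by rewrite size_polyDl ?size_polyN.
have qm : q \is monic by rewrite monicE lead_coefDl ?size_polyN // -monicE.
have q2 : q`_2 = f`_2 - l ^+ 2.
  rewrite coefB L2 !(coefD, coefZ, coefXn, coefX, coefC) /=; ring.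
have r1 : q.[x1] = 0 by rewrite !hornerE -h1 /=; ring.
have r2 : q.[x2] = 0 by rewrite !hornerE -h2 {1}hl /=; ring.
have := @cubic_factor q x1 x2 qm qs.
rewrite q2 opprB; apply.
have [e|ne] := eqVneq x1 x2; last first.
  rewrite Gauss_dvdp; last by rewrite coprimep_XsubC root_XsubC eq_sym.
  by rewrite !dvdp_XsubCl /root r1 r2 eqxx.
rewrite -e.
have y10 : y1 != 0.
  apply: contraNneq hne => y0; rewrite e eqxx /=.
  by rewrite hl e subrr mulr0 y0 addr0 oppr0.
have /factor_theorem [r qE] : root q x1 by rewrite /root r1.
have : root r x1.
  have : q^`().[x1] = 0.
    have lE : l = f^`().[x1] / (2 * y1) by rewrite /l /lam e eqxx.
    rewrite /q L2 !(derivN, derivD, derivZ, derivXn, derivX, derivC) !hornerE /= lE.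
    by field; rewrite n2 y10.
  by rewrite qE derivM derivXsubC !hornerE /= subrr mulr0 add0r /root => ->.
by case/factor_theorem => s rE; rewrite qE rE -mulrA dvdp_mull.
Qed.

Lemma ecadd_on p q : onc p -> onc q -> onc (ecadd f p q).
Proof.
case: p q => [[x1 y1]|] [[x2 y2]|] //= h1 h2; case: ifP => // /negbT hne.
have [hl /(congr1 (fun u => u.[(lam x1 y1 x2 y2) ^+ 2 - f`_2 - x1 - x2]))] := ec_line h1 h2 hne.
rewrite -/(lam x1 y1 x2 y2); set l := lam _ _ _ _; set x3 := _ - x2.
rewrite !hornerE /= subrr mulr0 => /eqP; rewrite subr_eq0 => /eqP ->.
by apply/eqP; ring.
Qed.

Lemma ecopp_on p : onc p -> onc (ecopp p).
Proof. by case: p => [[x y]|] //=; rewrite sqrrN. Qed.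

Lemma ecaddC p q : onc p -> onc q -> ecadd f p q = ecadd f q p.
Proof.
case: p q => [[x1 y1]|] [[x2 y2]|] //= h1 h2.
rewrite (eq_sym x2) [y2 == _]eq_sym eqr_oppLR; case: ifP => // /negbT hne.
have [hl _] := ec_line h1 h2 hne; move: hl; rewrite /lam.
have [e|ne] := eqVneq x1 x2 => hl.
  have -> : y2 = y1 by rewrite hl e subrr mulr0 add0r.
  by rewrite e; congr (Some (_, _)); ring.
have d1 : x2 - x1 != 0 by rewrite subr_eq0 eq_sym.
have d2 : x1 - x2 != 0 by rewrite subr_eq0.
by congr (Some (_, _)); field; rewrite d1 d2.
Qed.

Lemma ecadd0 p : ecadd f None p = p. Proof. by []. Qed.
Lemma ecaddN p : ecadd f (ecopp p) p = None.
Proof. by case: p => [[x y]|] //=; rewrite !eqxx. Qed.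

Lemma ecadd_eq0 p q : ecadd f p q = None -> q = ecopp p.
Proof.
case: p q => [[x1 y1]|] [[x2 y2]|] //=; case: ifP => // /andP[/eqP -> /eqP ->] _.
by rewrite opprK.
Qed.

Lemma crnormX u : crnorm (cX u) = u ^+ 2.
Proof. by rewrite /crnorm /=; ring. Qed.

Lemma Ip_mem_sub a b g : g \in [:: cX ('X - a%:P); cY - cX b%:P] ->
  Ip (Some (a, b)) g.
Proof. by rewrite !inE => /orP[] /eqP -> /=; rewrite /creval /= !hornerE; ring. Qed.

Lemma iprod_gens x1 y1 x2 y2 (N : coordring f -> Prop) :
  onc (Some (x1, y1)) -> onc (Some (x2, y2)) -> cideal N ->
  N (cX ('X - x1%:P) * cX ('X - x2%:P)) ->
  N (cX ('X - x1%:P) * (cY - cX y2%:P)) ->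
  N ((cY - cX y1%:P) * cX ('X - x2%:P)) ->
  N ((cY - cX y1%:P) * (cY - cX y2%:P)) ->
  forall g, iprod (Ip (Some (x1, y1))) (Ip (Some (x2, y2))) g -> N g.
Proof.
move=> /eqP h1 /eqP h2 HN n11 n12 n21 n22 g; apply=> // i j.
case/(ptidealP _ h1) => r [s ->] /(ptidealP _ h2) [r' [s' ->]].
have [_ hD hM] := HN.
set A := cX _ in n11 n12 n21 n22 *; set B := cX ('X - x2%:P) in n11 n12 n21 n22 *.
set C := cY - cX y1%:P in n11 n12 n21 n22 *; set D := cY - cX y2%:P in n11 n12 n21 n22 *.
have -> : (r * A + s * C) * (r' * B + s' * D) =
   r * r' * (A * B) + r * s' * (A * D) + (s * r' * (C * B) + s * s' * (C * D)) by ring.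
by apply: (hD); apply: (hD); apply: (hM).
Qed.

Lemma principal_ideal (g : coordring f) (I : coordring f -> Prop) (c : coordring f) :
  cideal I -> cideal (fun x => exists2 j, I j & c * x = g * j).
Proof.
case=> [h0 hD hM]; split; first by exists 0; rewrite ?mulr0.
- by move=> a b [i Ii ei] [j Ij ej]; exists (i + j); rewrite ?mulrDr ?ei ?ej; auto.
- by move=> r a [i Ii ei]; exists (r * i); [auto | rewrite !(mulrCA _ r) ei].
Qed.

Lemma Ip_ideal p : onc p -> cideal (Ip p).
Proof. by case: p => [[a b]|] // /eqP; apply: ptideal_ideal. Qed.

Lemma ceq_vert x y : onc (Some (x, y)) ->
  ceq (iprod (Ip (Some (x, y))) (Ip (Some (x, - y)))) (Ip None).
Proof.
move=> h; have h' := ecopp_on h; rewrite /= in h'.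
pose A := cX ('X - x%:P).
have [I0 ID IM] := iprod_ideal (Ip (Some (x, y))) (Ip (Some (x, - y))).
have hf : root (f - (y ^+ 2)%:P) x.
  by rewrite /root !hornerE subr_eq0 eq_sym.
have [g gE] := factor_theorem _ _ hf.
have fE : cX f = cX g * A + cX (y ^+ 2)%:P by rewrite -crXM -gE -crXD subrK.
have YE : (cY - cX y%:P) * (cY - cX (- y)%:P) = cX g * A.
  rewrite polyCN crXN opprK.
  have -> : (cY - cX y%:P) * (cY + cX y%:P) = cY * cY - cX y%:P * cX y%:P by ring.
  by rewrite crYY fE -crXM -polyCM expr2 addrK.
exists 1, A; split.
- by rewrite crnorm1 oner_eq0.
- by rewrite crnormX expf_neq0 // polyXsubC_eq0.
- move=> i Hi; have HT := principal_ideal A 1 (Ip_ideal (isT : onc None)).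
  apply: (iprod_gens h h' HT) Hi.
  + by exists A; rewrite // mul1r.
  + by exists (cY - cX (- y)%:P); rewrite // mul1r.
  + by exists (cY - cX y%:P); rewrite // mul1r mulrC.
  + by exists (cX g); rewrite // mul1r YE mulrC.
move=> j _; exists (A * j); last by rewrite mul1r.
rewrite mulrC; apply: (IM).
have A1 : Ip (Some (x, y)) A by apply: Ip_mem_sub; rewrite !inE eqxx.
have A2 : Ip (Some (x, - y)) A by apply: Ip_mem_sub; rewrite !inE eqxx.
have B1 : Ip (Some (x, y)) (cY - cX y%:P) by apply: Ip_mem_sub; rewrite !inE eqxx orbT.
have B2 : Ip (Some (x, - y)) (cY - cX (- y)%:P) by apply: Ip_mem_sub; rewrite !inE eqxx orbT.
have [y0|y0] := eqVneq y 0; last first.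
  have -> : A = cX ((2 * y)^-1)%:P * (A * (cY - cX (- y)%:P)) +
                cX (- (2 * y)^-1)%:P * ((cY - cX y%:P) * A).
    have e : cX ((2 * y)^-1)%:P * (cX y%:P + cX y%:P) = 1.
      rewrite -crXD -crXM -polyCD -polyCM.
      by rewrite half2.
    rewrite -{1}[A]mulr1 -e !polyCN !crXN; ring.
  by apply: (ID); apply: (IM); apply: iprod_mem.
have g0 : g.[x] != 0.
  have fx : f.[x] = 0 by move: h => /eqP <-; rewrite y0 expr0n.
  move: gE; rewrite y0 expr0n /= subr0 => gE.
  have := ec_root_deriv fx; rewrite gE derivM derivXsubC !hornerE /=.
  by rewrite subrr mulr0 add0r.
have [k kE] : exists k, g - (g.[x])%:P = k * ('X - x%:P).
  by apply/factor_theorem; rewrite /root !hornerE subrr.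
have -> : A = cX ((g.[x])^-1)%:P * ((cY - cX y%:P) * (cY - cX (- y)%:P)) +
      cX (- (g.[x])^-1 *: k) * (A * A).
  rewrite YE -!crXM -crXD; congr cX.
  rewrite -mul_polyC polyCN.
  have e : (g.[x]^-1)%:P * (g.[x])%:P = 1 by rewrite -polyCM mulVf.
  set c := (g.[x]^-1)%:P in e *; set D := 'X - x%:P in kE *.
  have -> : c * (g * D) + - c * k * (D * D) = c * (g - k * D) * D by ring.
  by rewrite -kE opprB addrC subrK e mul1r.
by apply: (ID); apply: (IM); apply: iprod_mem.
Qed.

Lemma ceq_add p q : onc p -> onc q -> ceq (iprod (Ip p) (Ip q)) (Ip (ecadd f p q)).
Proof.
have aux r : onc r -> ceq (iprod (Ip None) (Ip r)) (Ip r).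
  move=> hr; have Hr := Ip_ideal hr; apply: ceq_ext => x.
    by apply=> // i j _; have [_ _] := Hr; apply.
  by rewrite -{2}[x]mul1r => Hx; apply: iprod_mem.
case: p => [[x1 y1]|]; last by move=> _; apply: aux.
case: q => [[x2 y2]|] h1 h2; last first.
  apply: (ceq_trans _ (aux _ h1)).
  by apply: ceq_ext => x; apply: iprodC.
rewrite /ecadd; case: ifP => [/andP[/eqP e1 /eqP e2]|/negbT hne].
  by have -> : y2 = - y1; [rewrite e2 opprK | rewrite -e1; apply: ceq_vert].
have [hl hF] := ec_line h1 h2 hne.
have h3 := ecadd_on h1 h2; rewrite /= (negPf hne) in h3.
rewrite -/(lam x1 y1 x2 y2) in h3 *; move: hl hF h3; set l := lam _ _ _ _ => hl hF.
set x3 := l ^+ 2 - f`_2 - x1 - x2 in hF *; set y3 := l * (x1 - x3) - y1 => h3.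
pose A := cX ('X - x1%:P); pose B := cX ('X - x2%:P); pose C := cX ('X - x3%:P).
pose cl := cX l%:P.
pose L := cY - cX y1%:P - cl * A; pose L' := cY + cX y1%:P + cl * A.
have LL : L * L' = A * B * C.
  have -> : A * B * C = cX (f - (l *: ('X - x1%:P) + y1%:P) ^+ 2).
    by rewrite hF !crXM.
  rewrite /L /L'.
  have -> : (cY - cX y1%:P - cl * A) * (cY + cX y1%:P + cl * A) =
     cY * cY - (cl * A + cX y1%:P) * (cl * A + cX y1%:P) by ring.
  by rewrite crYY /cl /A -(crXM f l%:P) -crXD -crXM -crXN -crXD mul_polyC expr2.
have BE : cl * B = cl * A + cX y1%:P - cX y2%:P.
  rewrite -!crXM -crXD -crXN -crXD; congr cX.
  rewrite hl !(polyCD, polyCM, polyCN); ring.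
have CE : cY - cX y3%:P = L' - cl * C.
  rewrite /L' -!crXM /y3 !(polyCD, polyCM, polyCN) !(crXD, crXN, crXM); ring.
have D1E : cY - cX y1%:P = L + cl * A by rewrite /L; ring.
have D2E : cY - cX y2%:P = L + cl * B by rewrite BE /L; ring.
have [I0 ID IM] := iprod_ideal (Ip (Some (x1, y1))) (Ip (Some (x2, y2))).
have [J0 JD JM] := Ip_ideal h3.
have [K0 KD KM] := Ip_ideal h1.
have [M0 MD MM] := Ip_ideal h2.
have A1 : Ip (Some (x1, y1)) A by apply: Ip_mem_sub; rewrite !inE eqxx.
have B2 : Ip (Some (x2, y2)) B by apply: Ip_mem_sub; rewrite !inE eqxx.
have C3 : Ip (Some (x3, y3)) C by apply: Ip_mem_sub; rewrite !inE eqxx.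
have L1 : Ip (Some (x1, y1)) L.
  have -> : L = (cY - cX y1%:P) + (- cl) * A by rewrite D1E; ring.
  by apply: (KD); [apply: Ip_mem_sub; rewrite !inE eqxx orbT | apply: (KM)].
have L2 : Ip (Some (x2, y2)) L.
  have -> : L = (cY - cX y2%:P) + (- cl) * B by rewrite D2E; ring.
  by apply: (MD); [apply: Ip_mem_sub; rewrite !inE eqxx orbT | apply: (MM)].
have L3 : Ip (Some (x3, y3)) L'.
  have -> : L' = (cY - cX y3%:P) + cl * C by rewrite CE; ring.
  by apply: (JD); [apply: Ip_mem_sub; rewrite !inE eqxx orbT | apply: (JM)].
have LP : iprod (Ip (Some (x1, y1))) (Ip (Some (x2, y2))) L.
  have [e|ne] := eqVneq x1 x2; last first.
    have -> : L = cX ((x2 - x1)^-1)%:P * (A * L) + cX (- (x2 - x1)^-1)%:P * (L * B).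
      have e : cX ((x2 - x1)^-1)%:P * (A - B) = 1.
        rewrite -crXN -crXD -crXM.
        have -> : 'X - x1%:P - ('X - x2%:P) = (x2 - x1)%:P by rewrite polyCB; ring.
        by rewrite -polyCM mulVf // subr_eq0 eq_sym.
      rewrite -{1}[L]mul1r -e !polyCN !crXN; ring.
    by apply: (ID); apply: (IM); apply: iprod_mem.
  have y12 : y2 = y1 by rewrite hl e subrr mulr0 add0r.
  have y10 : y1 != 0.
    by apply: contraNneq hne => y0; rewrite e eqxx y12 y0 oppr0 /=.
  have BA : B = A by rewrite /B -e.
  have -> : L = cX ((2 * y1)^-1)%:P * (C * (A * B) + (- 1) * (L * L) + (- (2 * cl)) * (A * L)).
    have e' : cX ((2 * y1)^-1)%:P * (cX y1%:P + cX y1%:P) = 1.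
      rewrite -crXD -crXM -polyCD -polyCM.
      by rewrite half2.
    have -> : C * (A * B) = L * L' by rewrite LL; ring.
    have -> : L' = L + (cX y1%:P + cX y1%:P) + 2 * cl * A by rewrite /L /L'; ring.
    transitivity (cX ((2 * y1)^-1)%:P * (cX y1%:P + cX y1%:P) * L); last by ring.
    by rewrite e' mul1r.
  by do ?[apply: (ID)]; apply: (IM); do ?[apply: (ID)]; apply: (IM); apply: iprod_mem.
exists C, L; split.
- by rewrite crnormX expf_neq0 // polyXsubC_eq0.
- have : crnorm L * crnorm L' != 0.
    by rewrite -crnormM LL !crnormM !crnormX !mulf_neq0 // polyXsubC_eq0.
  by apply: contraNneq => ->; rewrite mul0r.
- move=> i Hi; have HT := principal_ideal L C (Ip_ideal h3).
  apply: (iprod_gens h1 h2 HT) Hi; rewrite -/A -/B.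
  + by exists L'; rewrite // LL; ring.
  + exists (A * C + cl * L'); first by apply: (JD); apply: (JM).
    have -> : L * (A * C + cl * L') = L * A * C + cl * (L * L') by ring.
    by rewrite D2E LL; ring.
  + exists (B * C + cl * L'); first by apply: (JD); apply: (JM).
    have -> : L * (B * C + cl * L') = L * B * C + cl * (L * L') by ring.
    by rewrite D1E LL; ring.
  exists ((L + cl * A + cl * B) * C + cl * cl * L').
    by apply: (JD); apply: (JM).
  rewrite D1E D2E (_ : L * _ = L * (L + cl * A + cl * B) * C + cl * cl * (L * L')).
    by rewrite LL; ring.
  by ring.
move=> j /(ptidealP _ (eqP h3)) [r [s ->]]; rewrite -/C CE.
exists (r * L + s * (A * B + (- cl) * L)).
  by apply: (ID); apply: (IM) => //; apply: (ID); [apply: iprod_mem | apply: (IM)].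
rewrite mulrDr (mulrDr L).
have -> : L * (s * (L' - cl * C)) = s * (L * L' - cl * L * C) by ring.
by rewrite LL; ring.
Qed.

Lemma crnorm_size_neq2 (g : coordring f) : size (crnorm g) != 2%N.
Proof.
have hu := size_exp g.1 2; rewrite /crnorm; have [v0|v0] := eqVneq g.2 0.
  rewrite v0 expr0n mul0r subr0; apply/eqP => e; move: hu; rewrite e; lia.
have hv := size_exp g.2 2.
have v20 : g.2 ^+ 2 != 0 by rewrite expf_neq0.
have sv : size (- (g.2 ^+ 2 * f)) = (size (g.2 ^+ 2) + 3)%N.
  by rewrite size_polyN size_Mmonic // fs addn4 addn3.
move: v20; rewrite -size_poly_gt0 => v20.
have [lt|lt|e] := ltngtP (size (g.1 ^+ 2)) (size (- (g.2 ^+ 2 * f))).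
- by rewrite addrC size_polyDl // sv; lia.
- by rewrite size_polyDl //; lia.
exfalso; rewrite sv in e; move: hu hv v20; rewrite e; clear; move: (size _) (size _) (size _) => x y z; lia.
Qed.

Lemma Ip_nonprincipal a b : onc (Some (a, b)) -> ~ ceq (Ip (Some (a, b))) (Ip None).
Proof.
move=> hP [g [h [g0 h0 H1 H2]]]; have /eqP hb := hP.
have [i Ii ei] := H2 1 I; rewrite mulr1 in ei.
have div j : Ip (Some (a, b)) j -> exists r, j = i * r.
  case/H1 => r _ e; exists r; apply: (cr_cancel g0).
  by rewrite e mulrA ei.
have i0 : crnorm i != 0.
  by apply: contraNneq h0 => i0; rewrite -ei crnormM i0 mulr0.
have norm1 (c : coordring f) : size (crnorm c) = 1%N ->
    exists2 k : K, k != 0 & c * crconj c = cX k%:P.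
  move/eqP/size_poly1P => [k k0 e]; exists k => //.
  by rewrite crmul_conj e.
have [r er] := div _ (@Ip_mem_sub a b _ (mem_head _ _)).
have [s es] : exists s, cY - cX b%:P = i * s.
  by apply: div; apply: Ip_mem_sub; rewrite !inE eqxx orbT.
have hN : ('X - a%:P) ^+ 2 = crnorm i * crnorm r by rewrite -crnormM -er crnormX.
have r0 : crnorm r != 0.
  apply: contraTneq (isT : true) => r0; move/eqP: hN.
  by rewrite r0 mulr0 expf_eq0 polyXsubC_eq0.
have sN : (size (crnorm i) + size (crnorm r) = 4)%N.
  have := size_exp_XsubC 2 a; rewrite hN size_mul //.
  by case: (_ + _)%N => // n /= ->.
have := crnorm_size_neq2 i; have := i0; have := r0.
rewrite -!size_poly_gt0 => r1 i1 n2i.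
have [/norm1[k k0 e]|/norm1[k k0 e]] :
    size (crnorm i) = 1%N \/ size (crnorm r) = 1%N by lia.
  have := crevalM i (crconj i) hb; rewrite e (Ii : creval a b i = 0) mul0r.
  by rewrite /creval /= !hornerE => /eqP; rewrite (negPf k0).
have e2 : cX k%:P * (cY - cX b%:P) = cX ('X - a%:P) * (s * crconj r).
  by rewrite es er -e; ring.
have /(congr1 (size \o @polyseq K)) /= := congr1 snd e2.
rewrite !(mul0r, mulr0, addr0, add0r, subr0, mulr1) size_polyC k0.
set q := (X in ('X - _) * X); have [->|q0] := eqVneq q 0.
  by rewrite mulr0 size_poly0.
by rewrite mulrC size_Mmonic ?monicXsubC // size_XsubC; move: q0; rewrite -size_poly_gt0; lia.
Qed.

Lemma Ip_inj p q : onc p -> onc q -> ceq (Ip p) (Ip q) -> p = q.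
Proof.
move=> hp hq /(ceq_iprodl (Ip (ecopp q))) H.
have hoq := ecopp_on hq.
have {}H := ceq_trans (ceq_sym (ceq_add hp hoq)) (ceq_trans H (ceq_add hq hoq)).
rewrite (ecaddC hq hoq) ecaddN in H.
have := ecadd_on hp hoq; have := @ecadd_eq0 p (ecopp q).
case: (ecadd f p (ecopp q)) H => [[a b]|] H e hab.
  by case: (Ip_nonprincipal hab H).
by move: (e erefl); case: (p) (q) => [[x y]|] [[x' y']|] //= [-> /oppr_inj ->].
Qed.

Lemma ecaddA p q r : onc p -> onc q -> onc r ->
  ecadd f p (ecadd f q r) = ecadd f (ecadd f p q) r.
Proof.
move=> hp hq hr; have hpq := ecadd_on hp hq; have hqr := ecadd_on hq hr.
apply: Ip_inj; try exact: ecadd_on.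
apply: ceq_trans (ceq_sym (ceq_add hp hqr)) _.
apply: ceq_trans (ceq_iprodr _ (ceq_sym (ceq_add hq hr))) _.
apply: ceq_sym.
apply: ceq_trans (ceq_sym (ceq_add hpq hr)) _.
apply: ceq_trans (ceq_iprodl _ (ceq_sym (ceq_add hp hq))) _.
by apply: ceq_ext => x; [apply: iprodA | apply: iprodA'].
Qed.

Definition ecpoint_add (P Q : ecpoint E) : ecpoint E :=
  EcPoint (ecadd_on (eccoordP P) (eccoordP Q)).
Definition ecpoint_opp (P : ecpoint E) : ecpoint E :=
  EcPoint (ecopp_on (eccoordP P)).
Definition ecpoint_zero : ecpoint E := @EcPoint K E None isT.

Lemma ecpoint_addA : associative ecpoint_add.
Proof.
by move=> P Q S; apply: val_inj; apply: ecaddA; apply: eccoordP.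
Qed.
Lemma ecpoint_addC : commutative ecpoint_add.
Proof. by move=> P Q; apply: val_inj; apply: ecaddC; apply: eccoordP. Qed.
Lemma ecpoint_add0 : left_id ecpoint_zero ecpoint_add.
Proof. by move=> P; apply: val_inj. Qed.
Lemma ecpoint_addN : left_inverse ecpoint_zero ecpoint_opp ecpoint_add.
Proof. by move=> P; apply: val_inj; apply: ecaddN. Qed.

HB.instance Definition _ := GRing.isZmodule.Build (ecpoint E)
  ecpoint_addA ecpoint_addC ecpoint_add0 ecpoint_addN.

End GroupLaw.

Definition has_order (V : zmodType) (x : V) (n : nat) : Prop :=
  [/\ (0 < n)%N, x *+ n = 0 & forall m : nat, (0 < m < n)%N -> x *+ m != 0].

(* Main.v *)
(** Writing [r_i = b_i / 2], the roots of the cubic are [- r_i ^ 2], so that [x - e_i] is a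
    square at [P = (0, - r1 r2 r3)] for every root [e_i], and explicit 2-descent gives [Q] with
    [Q *+ 2 = P]. As [r1 + r2 = a3 ^ 2] and cyclically, [x(Q) - e_i] are again squares,
    [(a2 a3) ^ 2] and so on, whence [R] with [R *+ 2 = Q]. Up to nonzero factors, the cubic
    condition on the [a_i] says [x(R) = 0], i.e. [R = P] or [R = - P], and the product condition
    says [x(Q) <> 0], i.e. [Q] is neither [P] nor [- P]. Since [Q = R *+ 2], this excludes
    [R = P] (then [P *+ 4 = P], so [Q = P *+ 2 = - P]) and leaves [R = - P], so [P *+ 5 = 0].
    The rational 2-torsion supplies the rest of the subgroup. *)
Require Import Defs.
From HB Require Import structures.
From mathcomp Require Import all_boot all_order all_algebra.
From mathcomp Require Import separable ring zify.

Set Implicit Arguments.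
Unset Strict Implicit.
Unset Printing Implicit Defensive.

Import GRing.Theory.
Local Open Scope ring_scope.

(** * Smoothness of split cubics *)

Lemma elliptic_cubic_prod (K : fieldType) (e1 e2 e3 : K) :
  2%N \notin [pchar K] -> uniq [:: e1; e2; e3] ->
  elliptic_cubic (('X + e1%:P) * ('X + e2%:P) * ('X + e3%:P)).
Proof.
move=> hK he; rewrite /elliptic_cubic hK /=.
have -> : ('X + e1%:P) * ('X + e2%:P) * ('X + e3%:P) =
    \prod_(x <- [:: - e1; - e2; - e3]) ('X - x%:P).
  by rewrite !big_cons big_nil !polyCN !opprK; ring.
rewrite monic_prod_XsubC size_prod_XsubC separable_prod_XsubC /=.
by move: he; rewrite /= !inE !(inj_eq oppr_inj).
Qed.

(** * Halving a point on a split cubic *)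

Section Halving.
Variables (K : fieldType) (c1 c2 c3 : K).
Let f := ('X + c1%:P) * ('X + c2%:P) * ('X + c3%:P).

Lemma horner_cubic_prod x : f.[x] = (x + c1) * (x + c2) * (x + c3).
Proof. by rewrite /f !hornerE. Qed.

Lemma coef2_cubic_prod : f`_2 = c1 + c2 + c3.
Proof.
have -> : f = 'X^3 + (c1 + c2 + c3) *: 'X^2 + (c1 * c2 + c1 * c3 + c2 * c3) *: 'X
    + (c1 * c2 * c3)%:P.
  by rewrite /f -!mul_polyC !(polyCD, polyCM); ring.
by rewrite !(coefD, coefZ, coefXn, coefX, coefC) /=; ring.
Qed.

(* The tangent at the half point has slope [- (s1 + s2 + s3)]. *)
Lemma ecadd_halving x y xq yq s1 s2 s3 : (2 : K) != 0 ->
  x + c1 = s1 ^+ 2 -> x + c2 = s2 ^+ 2 -> x + c3 = s3 ^+ 2 ->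
  s1 + s2 != 0 -> s2 + s3 != 0 -> s3 + s1 != 0 ->
  y = - (s1 * s2 * s3) -> xq = x + s1 * s2 + s2 * s3 + s3 * s1 ->
  yq = - ((s1 + s2) * (s2 + s3) * (s3 + s1)) ->
  on_curve f (Some (xq, yq)) /\
  ecadd f (Some (xq, yq)) (Some (xq, yq)) = Some (x, y).
Proof.
move=> n2 h1 h2 h3 n12 n23 n31 yE xqE yqE /=.
have d1 : c1 = s1 ^+ 2 - x by rewrite -h1; ring.
have d2 : c2 = s2 ^+ 2 - x by rewrite -h2; ring.
have d3 : c3 = s3 ^+ 2 - x by rewrite -h3; ring.
have yq0 : yq != 0 by rewrite yqE oppr_eq0 !mulf_neq0.
(* Here [xq + c1 = (s1 + s2) * (s1 + s3)], and cyclically, so the product is [yq ^ 2]. *)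
split; first by apply/eqP; rewrite horner_cubic_prod d1 d2 d3 yqE xqE; ring.
(* As [2 * yq] is nonzero, the doubling is given by a tangent that is not vertical. *)
have -> : (yq == - yq) = false.
  by rewrite -addr_eq0 -mulr2n -[yq]mulr1 -mulrnAr mulf_eq0 (negPf n2) (negPf yq0).
rewrite andbF eqxx.
have -> : f^`().[xq] / (2 * yq) = - (s1 + s2 + s3).
  apply: (mulIf (mulf_neq0 n2 yq0)); rewrite divfK ?mulf_neq0 //.
  rewrite /f !(derivM, derivD, derivX, derivC) !hornerE /= d1 d2 d3 yqE xqE; ring.
rewrite coef2_cubic_prod d1 d2 d3 yE yqE xqE; congr (Some (_, _)); ring.
Qed.

End Halving.

(** * Subgroups spanned by torsion points *)

Section TorsionEmbedding.
Variable V : zmodType.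

(** Addition in ['Z_n] reduces representatives modulo [n], and [n] kills [x]. The modulus of ['Z_n]
    is [n] only for [1 < n]. *)
Lemma mulrn_Zp_additive (n : nat) (x : V) : (1 < n)%N -> x *+ n = 0 ->
  forall u v : 'Z_n, x *+ (u + v)%R = x *+ u + x *+ v.
Proof.
move=> n1 hx u v; rewrite -mulrnDr [in RHS](divn_eq (u + v) n) mulrnDr.
rewrite mulnC mulrnA hx mul0rn add0r; congr (_ *+ (_ %% _)); exact: Zp_cast.
Qed.

Lemma has_order5 (P : V) : P != 0 -> P *+ 5 = 0 -> has_order P 5.
Proof.
move=> P0 P5; split=> // m /andP[m0 m5]; apply: contraNneq P0 => Pm.
(* [k] is an inverse of [m] modulo 5, with quotient [j]. *)
have inv k j : (m * k = 5 * j + 1)%N -> P = 0.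
  by move=> e; rewrite -(mul0rn V k) -Pm -mulrnA e mulrnDr mulrnA P5 mul0rn add0r.
have [e|[e|[e|e]]] : m = 1%N \/ m = 2%N \/ m = 3%N \/ m = 4%N by lia.
- by apply/eqP/(inv 1%N 0%N); rewrite e.
- by apply/eqP/(inv 3%N 1%N); rewrite e.
- by apply/eqP/(inv 2%N 1%N); rewrite e.
- by apply/eqP/(inv 4%N 3%N); rewrite e.
Qed.

(** [P + T1] has order 10, and its multiple by 5 is [T1]; it generates the first factor and [T2] the
    second. *)
Lemma Z10xZ2_embedding (P T1 T2 : V) : has_order P 5 ->
  T1 *+ 2 = 0 -> T2 *+ 2 = 0 -> T1 != 0 -> T2 != 0 -> T1 != T2 ->
  exists phi : {additive ('Z_10 * 'Z_2)%type -> V}, injective phi.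
Proof.
move=> [_ P5 Pn] T12 T22 T1n T2n T1T2.
pose g (w : ('Z_10 * 'Z_2)%type) : V := (P + T1) *+ w.1 + T2 *+ w.2.
have PT10 : (P + T1) *+ 10 = 0.
  by rewrite mulrnDl (mulrnA P 5 2) P5 (mulrnA T1 2 5) T12 !mul0rn addr0.
have gD : {morph g : x y / x + y}.
  by move=> x y; rewrite /g /= !mulrn_Zp_additive // addrACA.
have gB : zmod_morphism g.
  move=> x y; rewrite -[in RHS](subrK y x) (gD (x - y)) addrK //.
pose phi : {additive ('Z_10 * 'Z_2)%type -> V} :=
  HB.pack g (GRing.isZmodMorphism.Build _ _ g gB).
exists phi; apply: raddf_inj => -[u v] /= guv.
have {guv}e : (P + T1) *+ u + T2 *+ v = 0 by [].
(* Doubling the relation [e] kills [T1] and [T2], so 5 divides [2 * u], hence [u]. *)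
have Pu : P *+ (2 * u %% 5) = 0.
  have := congr1 (fun z => z *+ 2) e; rewrite /= mul0rn mulrnDl -!mulrnA.
  rewrite [(v * 2)%N]mulnC [(u * 2)%N]mulnC (mulrnA T2) T22 mul0rn addr0 mulrnDl.
  rewrite (mulrnA T1) T12 mul0rn addr0 {1}(divn_eq (2 * u) 5) mulrnDr mulnC.
  by rewrite (mulrnA P 5) P5 mul0rn add0r.
have u5 : (2 * u %% 5 == 0)%N.
  apply: contraT => r0; have := Pn (2 * u %% 5)%N; rewrite Pu eqxx.
  by rewrite lt0n r0 ltn_mod => /(_ isT).
have [k [k2 uE]] : exists k, (k < 2)%N /\ u = (5 * k)%N :> nat.
  have : (u < 10)%N := ltn_ord u.
  by move: u5; move: (nat_of_ord u) => m; exists (m %/ 5)%N; lia.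
have PT5 : (P + T1) *+ 5 = T1.
  by rewrite mulrnDl P5 add0r (mulrnDr T1 4 1) (mulrnA T1 2 2) T12 mul0rn add0r.
(* The relation is now [T1 *+ k + T2 *+ v = 0] with [k, v < 2]; only [k = v = 0] survives. *)
move: e; rewrite uE mulrnA PT5; have v2 : (v < 2)%N := ltn_ord v.
have T2N : - T2 = T2 by apply/eqP; rewrite eq_sym -addr_eq0 -mulr2n T22.
case: k k2 uE => [|[|//]] _ uE;
  case vE: (nat_of_ord v) v2 => [|[|//]] _ /eqP.
- have -> : u = 0 by apply: ord_inj; rewrite uE.
  by have -> : v = 0 by apply: ord_inj; rewrite vE.
- by rewrite add0r (negPf T2n).
- by rewrite addr0 (negPf T1n).
- by rewrite addr_eq0 T2N (negPf T1T2).
Qed.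

End TorsionEmbedding.

(** * The family of curves and its point of order 5 *)

Theorem theorem8p3 (K : fieldType) (hK : 2%N \notin [pchar K])
    (a1 a2 a3 : K) (ha : uniq [:: a1; - a1; a2; - a2; a3; - a3]) :
  let b1 := - a1 ^+ 2 + a2 ^+ 2 + a3 ^+ 2 in
  let b2 := a1 ^+ 2 - a2 ^+ 2 + a3 ^+ 2 in
  let b3 := a1 ^+ 2 + a2 ^+ 2 - a3 ^+ 2 in
  b1 != 0 -> b2 != 0 -> b3 != 0 ->
  [/\ a1 != 0, a2 != 0, a3 != 0 & uniq [:: b1 ^+ 2; b2 ^+ 2; b3 ^+ 2]] /\
  let f := ('X + (b1 ^+ 2 / 4)%:P) * ('X + (b2 ^+ 2 / 4)%:P)
             * ('X + (b3 ^+ 2 / 4)%:P) in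
  exists hE : elliptic_cubic f,
  let E := EllCurve hE in
  exists hP : on_curve (ecpoly E) (Some (0, - (b1 * b2 * b3) / 8)),
  let P : ecpoint E := EcPoint hP in
  (exists Q : ecpoint E, P = Q *+ 2) /\
  (a1 ^+ 3 + a2 ^+ 3 + a3 ^+ 3 - a1 ^+ 2 * a2 - a1 * a2 ^+ 2
     - a2 ^+ 2 * a3 - a2 * a3 ^+ 2 - a1 ^+ 2 * a3 - a1 * a3 ^+ 2
     - 2 * a1 * a2 * a3 = 0 ->
   (a1 + a2 + a3) * (a1 - a2 - a3) * (a1 + a2 - a3) * (a1 - a2 + a3) != 0 ->
   has_order P 5 /\
   exists phi : {additive ('Z_10 * 'Z_2)%type -> ecpoint E}, injective phi).
Proof.
move=> b1 b2 b3 b10 b20 b30.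
have n2 : (2 : K) != 0 by rewrite inE in hK.
have n4 : (4 : K) != 0 by rewrite (natrM _ 2 2) mulf_neq0.
have n8 : (8 : K) != 0 by rewrite (natrM _ 2 4) mulf_neq0.
rewrite /= !inE !negb_or -!andbA in ha.
case/and5P: ha => a1n a12 a12' a13 /and5P[a13' _ _ _ /and5P[_ a2n a23 a23' /and4P[_ _ a3n _]]].
have opp_neq (x : K) : x != - x -> x != 0 by apply: contraNneq => ->; rewrite oppr0.
have {}a1n := opp_neq _ a1n; have {}a2n := opp_neq _ a2n; have {}a3n := opp_neq _ a3n.
rewrite -subr_eq0 in a12; rewrite -addr_eq0 in a12'.
rewrite -subr_eq0 in a13; rewrite -addr_eq0 in a13'.
rewrite -subr_eq0 in a23; rewrite -addr_eq0 in a23'.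
(* Used on [b2 - b1 = 2 * (a1 ^ 2 - a2 ^ 2)] times [b2 + b1 = 2 * a3 ^ 2], and its analogues. *)
have sq_neq (u v x y z : K) : x - y != 0 -> x + y != 0 -> z != 0 ->
    u ^+ 2 - v ^+ 2 = 4 * (x - y) * (x + y) * z ^+ 2 -> v ^+ 2 != u ^+ 2.
  by move=> xy xy' z0 e; rewrite eq_sym -subr_eq0 e !mulf_neq0.
have b12 : b1 ^+ 2 != b2 ^+ 2 by apply: (sq_neq _ _ _ _ _ a12 a12' a3n); rewrite /b1 /b2; ring.
have b13 : b1 ^+ 2 != b3 ^+ 2 by apply: (sq_neq _ _ _ _ _ a13 a13' a2n); rewrite /b1 /b3; ring.
have b23 : b2 ^+ 2 != b3 ^+ 2 by apply: (sq_neq _ _ _ _ _ a23 a23' a1n); rewrite /b2 /b3; ring.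
have hb : uniq [:: b1 ^+ 2; b2 ^+ 2; b3 ^+ 2].
  by rewrite /= !inE !negb_or b12 b13 b23.
split; first by split.
move=> f; have hE : elliptic_cubic f.
  by apply: elliptic_cubic_prod => //; rewrite -(map_inj_uniq (divIf n4)) in hb.
exists hE => E.
have half_sq (x : K) : 0 + x ^+ 2 / 4 = (x / 2) ^+ 2 by field; rewrite ?n2 ?n4.
have e12 : b1 / 2 + b2 / 2 = a3 ^+ 2 by rewrite /b1 /b2; field.
have e23 : b2 / 2 + b3 / 2 = a1 ^+ 2 by rewrite /b2 /b3; field.
have e31 : b3 / 2 + b1 / 2 = a2 ^+ 2 by rewrite /b1 /b3; field.
(* The formulas of [ecadd_halving] at [x = 0] with [s_i = b_i / 2]. *)
pose y := - (b1 * b2 * b3) / 8; pose xQ := (b1 * b2 + b2 * b3 + b3 * b1) / 4.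
pose yQ := - (a1 * a2 * a3) ^+ 2.
have [hQ QE] : on_curve f (Some (xQ, yQ)) /\
    ecadd f (Some (xQ, yQ)) (Some (xQ, yQ)) = Some (0, y).
  apply: (ecadd_halving n2 (half_sq b1) (half_sq b2) (half_sq b3)).
  - by rewrite e12 expf_neq0.
  - by rewrite e23 expf_neq0.
  - by rewrite e31 expf_neq0.
  - by rewrite /y; field; rewrite ?n2 ?n8.
  - by rewrite /xQ; field; rewrite ?n2 ?n4.
  - by rewrite e12 e23 e31 /yQ; ring.
have hP : on_curve f (Some (0, y)) by rewrite -QE; apply: (@ecadd_on _ E).
exists hP => P.
pose Q : ecpoint E := @EcPoint _ E _ hQ.
have PQ : P = Q *+ 2 by exact/val_inj/esym.
split; first by exists Q.
move=> hc hn.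
have xQ1 : xQ + b1 ^+ 2 / 4 = (a2 * a3) ^+ 2.
  by rewrite /xQ /b1 /b2 /b3; field; rewrite ?n2 ?n4.
have xQ2 : xQ + b2 ^+ 2 / 4 = (a3 * a1) ^+ 2.
  by rewrite /xQ /b1 /b2 /b3; field; rewrite ?n2 ?n4.
have xQ3 : xQ + b3 ^+ 2 / 4 = (a1 * a2) ^+ 2.
  by rewrite /xQ /b1 /b2 /b3; field; rewrite ?n2 ?n4.
(* The same formulas at [Q], with [s1 = a2 * a3], [s2 = a3 * a1], [s3 = a1 * a2]. *)
pose xR := xQ + a1 * a2 * a3 * (a1 + a2 + a3).
pose yR := - (a1 * a2 * a3 * (a1 + a2) * (a2 + a3) * (a1 + a3)).
have [hR RE] : on_curve f (Some (xR, yR)) /\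
    ecadd f (Some (xR, yR)) (Some (xR, yR)) = Some (xQ, yQ).
  apply: (ecadd_halving n2 xQ1 xQ2 xQ3).
  - by rewrite (_ : _ + _ = a3 * (a1 + a2)) ?mulf_neq0 //; ring.
  - by rewrite (_ : _ + _ = a1 * (a2 + a3)) ?mulf_neq0 //; ring.
  - by rewrite (_ : _ + _ = a2 * (a1 + a3)) ?mulf_neq0 //; ring.
  - by rewrite /yQ; ring.
  - by rewrite /xR; ring.
  - by rewrite /yR; ring.
have xR0 : xR = 0.
  (* [4 * xR] is [- (a1 + a2 + a3)] times the cubic form in [hc]. *)
  apply: (mulIf n4); rewrite mul0r -[RHS](mulr0 (- (a1 + a2 + a3))) -hc.
  by rewrite /xR /xQ /b1 /b2 /b3; field; rewrite ?n2.
have xQ0 : xQ != 0.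
  (* As in Heron's formula, the product of the four linear forms is [- (4 * xQ)]. *)
  apply: contraNneq hn => xQ0; apply/eqP; transitivity (- (4 * xQ)); last first.
    by rewrite xQ0 mulr0 oppr0.
  by rewrite /xQ /b1 /b2 /b3; field; rewrite ?n2.
pose R : ecpoint E := @EcPoint _ E _ hR.
have QR : Q = R *+ 2 by exact/val_inj/esym.
have QnP : Q <> - P by move/(congr1 (@eccoord _ _)) => -[/eqP]; rewrite (negPf xQ0).
have P5 : P *+ 5 = 0.
  have : yR ^+ 2 == y ^+ 2.
    by have /eqP -> := hP; have := hR; rewrite xR0.
  rewrite eqf_sqr => /orP[] /eqP yRE.
    (* Then [Q + (Q + P) = P *+ 2 = R *+ 2 = Q], so [Q = - P], a contradiction. *)
    have RP : R = P by apply: val_inj; rewrite /= xR0 yRE.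
    case: QnP; apply/eqP; rewrite -addr_eq0; apply/eqP.
    by apply: (addrI Q); rewrite addr0 addrA -mulr2n -PQ -mulr2n -{1}RP -QR.
  (* Then [P = R *+ 4 = (- P) *+ 4]. *)
  have RP : R = - P by apply: val_inj; rewrite /= xR0 yRE.
  by rewrite mulrSr {2}PQ QR RP -mulrnA mulNrn subrr.
have oP : has_order P 5 by apply: has_order5 => //; apply/eqP => /(congr1 (@eccoord _ _)).
split=> //.
(* Two distinct roots of [f] give two distinct points of order 2. *)
have hT1 : on_curve f (Some (- (b1 ^+ 2 / 4), 0)).
  by rewrite /= horner_cubic_prod addNr !mul0r expr0n.
have hT2 : on_curve f (Some (- (b2 ^+ 2 / 4), 0)).
  by rewrite /= horner_cubic_prod addNr mulr0 mul0r expr0n.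
have twoT x (hT : on_curve f (Some (x, 0))) : (@EcPoint _ E _ hT) *+ 2 = 0.
  by apply: val_inj; rewrite /= oppr0 !eqxx.
apply: (Z10xZ2_embedding oP (twoT _ hT1) (twoT _ hT2)).
- by apply/eqP => /(congr1 (@eccoord _ _)).
- by apply/eqP => /(congr1 (@eccoord _ _)).
apply/eqP => /(congr1 (@eccoord _ _)) -[/oppr_inj /(divIf n4) /eqP].
by rewrite (negPf b12).
Qed.
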